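(* Let $n\ge 1$ be an integer and let $A,B\subseteq\{2,3,\dots,n\}$. Then in $K_{0,n}$: $$E_AE_B=\begin{cases}E_A,&A=B,\\0,&A\ne B,\end{cases}\qquad E_AO_B=\begin{cases}O_A,&A=B,\\0,&A\neq B,\end{cases}\qquad O_AO_B=\begin{cases}-E_A,&A=B,\\0,&A\ne B.\end{cases}$$ Further, $\{E_B,O_B\;|\;B\subseteq\{2,3,\dots,n\}\}$ is a basis for $K_{0,n}$ (as a real vector space).
   Context: $K_{0,n}$ is the real associative algebra with unity generated by $e_1,\dots,e_n$ subject to $e_i^2=-1$ and $e_ie_j=e_je_i$ for all $i,j\in\{1,\dots,n\}$. For $A=\{i_1<\cdots<i_l\}\subseteq\{1,\dots,n\}$ put $e_A:=e_{i_1}\cdots e_{i_l}$, with $e_{\{\}}:=1$; the elements $e_A$, $A\subseteq\{1,\dots,n\}$, form a basis of $K_{0,n}$ as a real vector space (dimension $2^n$). For $U=\sum_A a_Ae_A$ with $a_A\in\mathbb{R}$, the grade-$k$ projection is $\langle U\rangle_k:=\sum_{|A|=k}a_Ae_A$ (zero if $k>n$). Operations of conjugation: for $l\in\{1,\dots,n\}$, $U\mapsto U^{(l)}$ is the linear map on $K_{0,n}$ replacing the generator $e_l$ by $-e_l$, i.e. $e_A^{(l)}=-e_A$ if $l\in A$ and $e_A^{(l)}=e_A$ if $l\notin A$. For $B=\{i_1,\dots,i_k\}\subseteq\{1,\dots,n\}$, $U^{(B)}$ denotes the result of applying the conjugations $(i_1),\dots,(i_k)$ successively (they commute), with $U^{(\{\})}:=U$.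 Define $f:=\frac{1}{2^{n-1}}\sum_{A\subseteq\{1,\dots,n\}}e_A\in K_{0,n}$, $$E:=\sum_{k=0}^{\lfloor n/2\rfloor}(-1)^k\langle f\rangle_{2k},\qquad O:=\sum_{k=0}^{\lfloor n/2\rfloor}(-1)^k\langle f\rangle_{2k+1},$$ and, for $B\subseteq\{2,3,\dots,n\}$, $E_B:=E^{(B)}$ and $O_B:=O^{(B)}$. *)

(* Defs.v *)
From HB Require Import structures.
From mathcomp Require Import all_boot all_order all_algebra.
From mathcomp Require Import reals ring.

Set Implicit Arguments.
Unset Strict Implicit.
Unset Printing Implicit Defensive.

Import Order.TTheory GRing.Theory Num.Theory.
Local Open Scope ring_scope.

Section SymmetricDifference.
Variable T : finType.
Implicit Types A B C D : {set T}.

Definition symdiff A B : {set T} := (A :\: B) :|: (B :\: A).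

Lemma in_symdiff A B x : (x \in symdiff A B) = (x \in A) (+) (x \in B).
Proof. by rewrite !inE; case: (x \in A); case: (x \in B). Qed.

Lemma symdiffC : commutative symdiff.
Proof. by move=> A B; apply/setP => x; rewrite !in_symdiff addbC. Qed.

Lemma symdiffA : associative symdiff.
Proof. by move=> A B C; apply/setP => x; rewrite !in_symdiff addbA. Qed.

Lemma symdiffK A : involutive (symdiff A).
Proof. by move=> B; apply/setP => x; rewrite !in_symdiff addKb. Qed.

Lemma symdiff0s A : symdiff set0 A = A.
Proof. by apply/setP => x; rewrite in_symdiff inE. Qed.

End SymmetricDifference.

(* K_{0,n} is modelled on coordinate families (a_A), A ranging over the
   subsets of the index set, with multiplication extended bilinearly from
     e_A e_B = (-1)^#|A :&: B| e_(A symdiff B).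
   The index i of the generator e_i runs through 'I_n = {0, ..., n-1}, so
   [gen i] is the generator usually numbered i + 1.  The lemmas [gen_sqr],
   [blade_basis] and [K0_presentation] below show that this algebra is
   the one presented by the generators e_i and the relations e_i^2 = -1,
   e_i e_j = e_j e_i, and that the e_A are a basis of it.  (The presented
   algebra is commutative, so commutative targets suffice in
   [K0_presentation].) *)
Definition K0 (R : realType) (n : nat) : Type := {ffun {set 'I_n} -> R^o}.

Section Algebra.
Variables (R : realType) (n : nat).

HB.instance Definition _ := Vector.copy (K0 R n) {ffun {set 'I_n} -> R^o}.

Local Notation K := (K0 R n).
Implicit Types (U V W : K) (A B C D : {set 'I_n}).

Definition coef U A : R := (U : {ffun {set 'I_n} -> R^o}) A.

Definition K0_of (c : {set 'I_n} -> R) : K :=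
  [ffun A => c A : R^o] : {ffun {set 'I_n} -> R^o}.

Lemma coef_of c A : coef (K0_of c) A = c A.
Proof. by rewrite /coef ffunE. Qed.

Lemma coefP U V : coef U =1 coef V -> U = V.
Proof. by move=> eUV; apply/ffunP. Qed.

Lemma coef0 A : coef 0 A = 0.
Proof. by rewrite /coef ffunE. Qed.

Lemma coefD U V A : coef (U + V) A = coef U A + coef V A.
Proof. by rewrite /coef ffunE. Qed.

Lemma coefN U A : coef (- U) A = - coef U A.
Proof. by rewrite /coef ffunE. Qed.

Lemma coefZ a U A : coef (a *: U) A = a * coef U A.
Proof. by rewrite /coef ffunE. Qed.

Lemma coef_sum I (r : seq I) (P : pred I) (F : I -> K) A :
  coef (\sum_(i <- r | P i) F i) A = \sum_(i <- r | P i) coef (F i) A.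
Proof.
by apply: (big_morph (coef^~ A)) => [U V|]; rewrite ?coef0 ?coefD.
Qed.

Definition sgn A B : R := (-1) ^+ #|A :&: B|.

Lemma sgnE A B :
  sgn A B = \prod_i (if (i \in A) && (i \in B) then -1 else 1).
Proof.
rewrite -big_mkcond /= prodr_const /sgn; congr (_ ^+ _).
by apply: eq_card => i; rewrite inE.
Qed.

Lemma sgnC A B : sgn A B = sgn B A.
Proof. by rewrite /sgn setIC. Qed.

Lemma sgn_cocycle A B D :
  sgn A (symdiff B D) * sgn B D = sgn (symdiff A B) D * sgn A B.
Proof.
rewrite !sgnE -!big_split /=; apply: eq_bigr => i _; rewrite !in_symdiff.
by case: (i \in A); case: (i \in B); case: (i \in D); rewrite /= ?mulr1 ?mul1r.
Qed.

Definition K0_one : K := K0_of (fun A => (A == set0)%:R).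

(* The coefficient of e_C collects the pairs (A, B) with A symdiff B = C. *)
Definition K0_mul U V : K := K0_of (fun C =>
  \sum_A sgn A (symdiff A C) * (coef U A * coef V (symdiff A C))).

Fact K0_mulA : associative K0_mul.
Proof.
move=> U V W; apply: coefP => C; rewrite !coef_of.
under eq_bigr => A _ do rewrite coef_of 2!mulr_sumr.
under [RHS]eq_bigr => A _ do rewrite coef_of mulr_suml mulr_sumr.
rewrite [RHS]exchange_big /=; apply: eq_bigr => A _.
rewrite [RHS](reindex_inj (inv_inj (symdiffK A))) /=; apply: eq_bigr => B _.
rewrite symdiffK -(symdiffA A B C).
set D := symdiff B (symdiff A C).
have eC : symdiff A (symdiff B C) = D.
  by rewrite /D !symdiffA (symdiffC A B).
have eA : symdiff A C = symdiff B D by rewrite /D symdiffK.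
rewrite eC eA; have := sgn_cocycle A B D.
set s1 := sgn A _; set s2 := sgn B D; set s3 := sgn _ D; set s4 := sgn A B.
move=> e; transitivity ((s1 * s2) * (coef U A * coef V B * coef W D)).
  by ring.
by rewrite e; ring.
Qed.

Fact K0_mulC : commutative K0_mul.
Proof.
move=> U V; apply: coefP => C; rewrite !coef_of.
have inj : injective (fun A => symdiff A C).
  by move=> A B; rewrite !(symdiffC _ C) => /(inv_inj (symdiffK C)).
rewrite (reindex_inj inj) /=; apply: eq_bigr => A _.
have -> : symdiff (symdiff A C) C = A.
  by rewrite (symdiffC A) (symdiffC _ C) symdiffK.
by rewrite sgnC; congr (_ * _); rewrite mulrC.
Qed.

Fact K0_mul1 : left_id K0_one K0_mul.
Proof.
move=> U; apply: coefP => C; rewrite coef_of (bigD1 set0) //= big1 => [|A nA].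
  by rewrite symdiff0s coef_of eqxx /sgn set0I cards0 !mul1r addr0.
by rewrite coef_of (negbTE nA) mul0r mulr0.
Qed.

Fact K0_mulDl : left_distributive K0_mul +%R.
Proof.
move=> U V W; apply: coefP => C; rewrite coefD !coef_of -big_split /=.
by apply: eq_bigr => A _; rewrite coefD mulrDl mulrDr.
Qed.

Fact K0_one_neq0 : K0_one != 0.
Proof.
apply/eqP => /(congr1 (coef^~ set0)); rewrite /= coef_of coef0 eqxx => /eqP.
by rewrite oner_eq0.
Qed.

HB.instance Definition _ := GRing.Zmodule_isComNzRing.Build K
  K0_mulA K0_mulC K0_mul1 K0_mulDl K0_one_neq0.

Fact K0_scalerAl (a : R) U V : a *: (U * V) = (a *: U) * V.
Proof.
apply: coefP => C; rewrite coefZ !coef_of mulr_sumr.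
by apply: eq_bigr => A _; rewrite coefZ mulrCA !mulrA.
Qed.

HB.instance Definition _ := GRing.Lmodule_isLalgebra.Build R K K0_scalerAl.
HB.instance Definition _ := GRing.Lalgebra_isComAlgebra.Build R K.

Lemma coefM U V C : coef (U * V) C =
  \sum_A sgn A (symdiff A C) * (coef U A * coef V (symdiff A C)).
Proof. exact: coef_of. Qed.

Lemma coef1 A : coef 1 A = (A == set0)%:R.
Proof. exact: coef_of. Qed.

Definition gen (i : 'I_n) : K := K0_of (fun A => (A == [set i])%:R).

(* e_A *)
Definition blade A : K := \prod_(i in A) gen i.

Definition delta A : K := K0_of (fun C => (C == A)%:R).

Lemma coefM_delta A V C :
  coef (delta A * V) C = sgn A (symdiff A C) * coef V (symdiff A C).
Proof.
rewrite coefM (bigD1 A) //= big1 => [|B nB].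
  by rewrite coef_of eqxx mul1r addr0.
by rewrite coef_of (negbTE nB) mul0r mulr0.
Qed.

Lemma bladeE A : blade A = delta A.
Proof.
have [m] := ubnP #|A|; elim: m => // m IHm in A * => leAm.
have [->|[i iA]] := set_0Vmem A; first by rewrite /blade big_set0.
rewrite /blade (big_setD1 i iA) -/(blade _) IHm; last first.
  by rewrite (cardsD1 i A) iA in leAm.
apply: coefP => C; rewrite coefM_delta !coef_of.
have -> : (symdiff [set i] C == A :\ i) = (C == A).
  apply/eqP/eqP => [/(congr1 (symdiff [set i]))|->].
    rewrite symdiffK => ->; apply/setP => j; rewrite in_symdiff !inE.
    by case: eqP => //= ->; rewrite iA.
  apply/setP => j; rewrite in_symdiff !inE.
  by case: eqP => //= ->; rewrite iA.
case: eqP => [->|_]; last by rewrite mulr0.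
have -> : symdiff [set i] A = A :\ i.
  apply/setP => j; rewrite in_symdiff !inE.
  by case: eqP => //= ->; rewrite iA.
have -> : sgn [set i] (A :\ i) = 1.
  rewrite /sgn (_ : _ :&: _ = set0) ?cards0 //.
  by apply/setP => j; rewrite !inE; case: eqP.
by rewrite mulr1.
Qed.

Lemma coef_blade A C : coef (blade A) C = (C == A)%:R.
Proof. by rewrite bladeE coef_of. Qed.

Lemma blade_sum U : U = \sum_(A : {set 'I_n}) coef U A *: blade A.
Proof.
apply: coefP => C; rewrite coef_sum (bigD1 C) //= big1 => [|A nA].
  by rewrite coefZ coef_blade eqxx mulr1 addr0.
by rewrite coefZ coef_blade eq_sym (negbTE nA) mulr0.
Qed.

Lemma gen_sqr i : gen i ^+ 2 = -1.
Proof.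
apply: coefP => C; rewrite expr2 coefM_delta coefN coef1 coef_of.
have -> : (symdiff [set i] C == [set i]) = (C == set0).
  apply/eqP/eqP => [/(congr1 (symdiff [set i]))|->].
    by rewrite symdiffK => ->; apply/setP => j; rewrite in_symdiff addbb inE.
  by rewrite symdiffC symdiff0s.
case: eqP => [->|_]; last by rewrite mulr0 oppr0.
by rewrite symdiffC symdiff0s /sgn setIid cards1 expr1 mulr1.
Qed.

Lemma blade_basis : basis_of fullv [seq blade A | A <- enum {set 'I_n}].
Proof.
rewrite basisEdim size_map -cardE dimvf.
apply/andP; split; last by rewrite [leqRHS]muln1.
apply/subvP => U _; rewrite [U]blade_sum; apply: memv_suml => A _.
by apply: memvZ; apply: memv_span; apply: map_f; rewrite mem_enum.
Qed.

Lemma K0_presentation (S : comAlgType R) (x : 'I_n -> S) :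
  (forall i, x i ^+ 2 = -1) ->
  exists f : {lrmorphism K -> S}, (forall i, f (gen i) = x i) /\
    forall g : {lrmorphism K -> S}, (forall i, g (gen i) = x i) -> g =1 f.
Proof.
move=> x2; pose xs A := \prod_(i in A) x i.
pose f U := \sum_(A : {set 'I_n}) coef U A *: xs A.
have f_lin : linear f.
  move=> a U V; rewrite /f scaler_sumr -big_split /=; apply: eq_bigr => A _.
  by rewrite coefD coefZ scalerDl scalerA.
have xsM A B : xs A * xs B = sgn A B *: xs (symdiff A B).
  rewrite -mulr_algl -in_algE sgnE rmorph_prod /xs /=.
  rewrite [X in X * _ = _]big_mkcond [X in _ * X = _]big_mkcond.
  rewrite [X in _ = _ * X]big_mkcond -!big_split /=; apply: eq_bigr => i _.
  rewrite in_symdiff; case: (i \in A); case: (i \in B);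
    by rewrite /= ?scale1r ?scaleN1r ?mulr1 ?mul1r // -expr2 x2.
have f_mul : monoid_morphism f.
  split=> [|U V].
    rewrite /f (bigD1 set0) //= big1 => [|A nA].
      by rewrite coef1 eqxx scale1r addr0 /xs big_set0.
    by rewrite coef1 (negbTE nA) scale0r.
  rewrite /f mulr_suml; under [LHS]eq_bigr => C _ do rewrite coefM scaler_suml.
  rewrite exchange_big /=; apply: eq_bigr => A _; rewrite mulr_sumr.
  rewrite (reindex_inj (inv_inj (symdiffK A))) /=; apply: eq_bigr => B _.
  rewrite symdiffK -scalerAl -scalerAr xsM !scalerA; congr (_ *: _); ring.
pose F : {lrmorphism K -> S} := HB.pack f
  (GRing.isLinear.Build R K S *:%R f f_lin)
  (GRing.isMonoidMorphism.Build K S f f_mul).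
exists F; split=> [i|g gx U]; rewrite /F /= /f.
  rewrite (bigD1 [set i]) //= big1 => [|A nA].
    by rewrite coef_of eqxx scale1r addr0 /xs big_set1.
  by rewrite coef_of (negbTE nA) scale0r.
rewrite {1}[U]blade_sum raddf_sum; apply: eq_bigr => A _.
rewrite /= linearZ /= /blade rmorph_prod; congr (_ *: _).
by apply: eq_bigr => i _; exact: gx.
Qed.

(* <U>_k *)
Definition grade (k : nat) U : K :=
  \sum_(A : {set 'I_n} | #|A| == k) coef U A *: blade A.

(* U^(l) *)
Definition conj1 (l : 'I_n) U : K :=
  \sum_(A : {set 'I_n}) coef U A *: (if l \in A then - blade A else blade A).

(* U^(B) *)
Definition conjs B U : K := foldr conj1 U (enum B).

Definition f0 : K := (2 ^+ (n - 1))^-1 *: \sum_(A : {set 'I_n}) blade A.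

Definition E0 : K :=
  \sum_(0 <= k < (n./2).+1) (-1) ^+ k *: grade (2 * k) f0.

Definition O0 : K :=
  \sum_(0 <= k < (n./2).+1) (-1) ^+ k *: grade (2 * k + 1) f0.

Definition E_ B : K := conjs B E0.
Definition O_ B : K := conjs B O0.

(* {2, ..., n} in the 1-based numbering: all indices except the first. *)
Definition tail_idx : {set 'I_n} := [set i : 'I_n | (0 < i)%N].

End Algebra.

(* Main.v *)
From Pilot Require Import Defs.
From HB Require Import structures.
From mathcomp Require Import all_boot all_order all_algebra.
From mathcomp Require Import reals.
(* Imported again so that coefD, coefM, coef_sum, ... denote the lemmas on
   coordinates in K_{0,n} rather than those on polynomials. *)
Import Pilot.Defs.

(** Every generator acts on [E0] in the same way: [gen j * E0 = O0], hence
    also [gen j * O0 = - E0].  In the complexified algebra this is the remark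
    that [E0] and [O0] are the real and imaginary parts of
    2 * prod_j (1 + i e_j) / 2, on which each e_j acts as the scalar -i; in
    coordinates it is a comparison of parities of cardinalities ([gen_E0]).
    Conjugation by B is a ring automorphism, so each e_j sends [E_ B] to
    [O_ B] up to a sign, negative exactly when j belongs to B ([gen_E]): the
    span of [E_ B] and [O_ B] is an ideal, and the list of signs tells these
    ideals apart.

    The first generator e_1 has sign +1 for every admissible B, so
    [O_ B = e_1 * E_ B] and all the products reduce to those of the [E_ B].
    If A and B differ at j, moving e_j from one factor of [E_ A * E_ B] to
    the other changes the sign while moving e_1 does not; hence the product
    vanishes ([E_orthogonal]).  Next, the sum of the [E_ B] over all
    admissible B is 1, by cancellation of characters ([sum_E]).  Multiplying
    this by [E_ A] and using orthogonality gives [E_ A * E_ A = E_ A].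
    Multiplying it by an arbitrary U writes U as a sum of members of the
    ideals, so the [E_ B] and [O_ B] span; there are 2^n of them, which is
    the dimension, so they form a basis. *)

Set Implicit Arguments.
Unset Strict Implicit.
Unset Printing Implicit Defensive.

Import Order.TTheory GRing.Theory Num.Theory.
Local Open Scope ring_scope.

Section Idempotents.
Variables (R : realType) (n : nat).
Local Notation K := (K0 R n).
Implicit Types (U V : K) (A B C : {set 'I_n}) (i j : 'I_n).

(** * Signs and conjugations *)

Lemma sgn_symdiff B A C : sgn R B (symdiff A C) = sgn R B A * sgn R B C.
Proof.
rewrite !sgnE -big_split /=; apply: eq_bigr => i _; rewrite in_symdiff.
by case: (i \in A); case: (i \in B); case: (i \in C);
  rewrite /= ?mulr1 ?mul1r ?mulrNN ?mulr1.
Qed.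

Lemma sgn_set1 B j : sgn R B [set j] = (-1) ^+ (j \in B).
Proof.
rewrite /sgn; case: (boolP (j \in B)) => jB.
  by rewrite (setIidPr _) ?sub1set // cards1.
by rewrite disjoint_setI0 ?cards0 // disjoint_sym disjoints1.
Qed.

Lemma sgn_sqr A B : sgn R A B * sgn R A B = 1.
Proof. by rewrite /sgn -expr2 sqrr_sign. Qed.

Lemma symdiff1_in j C : j \in C -> symdiff [set j] C = C :\ j.
Proof.
by move=> jC; apply/setP => i; rewrite in_symdiff !inE; case: eqP => // ->; rewrite jC.
Qed.

Lemma symdiff1_notin j C : j \notin C -> symdiff [set j] C = j |: C.
Proof.
move=> jC; apply/setP => i; rewrite in_symdiff !inE.
by case: eqP => // ->; rewrite (negbTE jC).
Qed.

Lemma coef_conj1 l U A : coef (conj1 l U) A = (-1) ^+ (l \in A) * coef U A.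
Proof.
rewrite coef_sum (bigD1 A) //= big1 => [|C nC].
  rewrite addr0 coefZ; case: (l \in A); rewrite ?coefN coef_blade eqxx.
    by rewrite expr1 mulrN1 mulN1r.
  by rewrite mulr1 mul1r.
rewrite coefZ; case: (l \in C); rewrite ?coefN coef_blade eq_sym (negbTE nC).
  by rewrite oppr0 mulr0.
by rewrite mulr0.
Qed.

(** Conjugations are diagonal in the basis of the blades, with a character of
    the group of subsets under symmetric difference as eigenvalues; that is
    why they respect products. *)
Lemma coef_conjs B U A : coef (conjs B U) A = sgn R B A * coef U A.
Proof.
have -> : sgn R B A = \prod_(l <- enum B) (-1) ^+ (l \in A).
  rewrite sgnE big_enum [RHS]big_mkcond /=; apply: eq_bigr => l _.
  by case: (l \in B); case: (l \in A).
rewrite /conjs; elim: (enum B) => [|l s IHs] /=; first by rewrite big_nil mul1r.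
by rewrite coef_conj1 IHs big_cons mulrA.
Qed.

Lemma conjsM B U V : conjs B (U * V) = conjs B U * conjs B V.
Proof.
apply: coefP => C; rewrite coef_conjs !coefM mulr_sumr; apply: eq_bigr => A _.
have -> : sgn R B C = sgn R B A * sgn R B (symdiff A C).
  by rewrite -sgn_symdiff symdiffK.
by rewrite !coef_conjs mulrCA; congr (_ * _); rewrite mulrACA.
Qed.

Lemma coef_gen j A : coef (gen R j) A = (A == [set j])%:R.
Proof. exact: coef_of. Qed.

Lemma conjs_gen B j : conjs B (gen R j) = sgn R B [set j] *: gen R j.
Proof.
apply: coefP => C; rewrite coef_conjs coefZ !coef_gen.
by case: eqP => [->|_] //; rewrite !mulr0.
Qed.

(** * The action of the generators on E and O *)

Lemma coef_grade k U C : coef (grade k U) C = if #|C| == k then coef U C else 0.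
Proof.
rewrite coef_sum big_mkcond (bigD1 C) //= big1 => [|A nA].
  by rewrite coefZ coef_blade eqxx mulr1 addr0.
by rewrite coefZ coef_blade (eq_sym C) (negbTE nA) mulr0 if_same.
Qed.

Lemma coef_f0 C : coef (f0 R n) C = (2 ^+ (n - 1))^-1.
Proof.
rewrite coefZ coef_sum (bigD1 C) //= big1 => [|A nA].
  by rewrite coef_blade eqxx addr0 mulr1.
by rewrite coef_blade eq_sym (negbTE nA).
Qed.

Lemma half_card C : (#|C|./2 < (n./2).+1)%N.
Proof. by rewrite ltnS half_leq // -[leqRHS](card_ord n) max_card. Qed.

Lemma coef_E0 C : coef (E0 R n) C =
  if odd #|C| then 0 else (-1) ^+ #|C|./2 / 2 ^+ (n - 1).
Proof.
rewrite coef_sum big_mkord; under eq_bigr => k _ do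
  rewrite coefZ coef_grade coef_f0 mul2n.
case: ifP => oC.
  by apply: big1 => k _; case: eqP => [eC|]; rewrite ?mulr0 //;
    rewrite eC odd_double in oC.
rewrite (bigD1 (Ordinal (half_card C))) //= big1 => [|k nk].
  by rewrite addr0 even_halfK ?oC // eqxx.
case: eqP => [eC|]; rewrite ?mulr0 //.
by case/eqP: nk; apply: val_inj; rewrite /= eC doubleK.
Qed.

Lemma coef_O0 C : coef (O0 R n) C =
  if odd #|C| then (-1) ^+ #|C|./2 / 2 ^+ (n - 1) else 0.
Proof.
rewrite coef_sum big_mkord; under eq_bigr => k _ do
  rewrite coefZ coef_grade coef_f0 mul2n addn1.
case: ifP => oC; last first.
  by apply: big1 => k _; case: eqP => [eC|]; rewrite ?mulr0 //;
    rewrite eC /= odd_double in oC.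
rewrite (bigD1 (Ordinal (half_card C))) //= big1 => [|k nk].
  by rewrite addr0 odd_halfK // prednK ?odd_gt0 // eqxx.
case: eqP => [eC|]; rewrite ?mulr0 //.
by case/eqP: nk; apply: val_inj; rewrite /= eC /= uphalf_double.
Qed.

(** Up to the common factor, the coordinates of [E0] and [O0] at C are the
    real and imaginary parts of i^m with m = #|C|.  The coordinate of a product
    by [gen j] at C comes from C without j if j is in C, and from C with j
    added, with a minus sign, otherwise.  The claim is thus the real part of
    i^(m-1) = - i * i^m in the first case, and of - i^(m+1) = - i * i^m in the
    second. *)
Lemma gen_E0 j : gen R j * E0 R n = O0 R n.
Proof.
apply: coefP => C; rewrite coefM_delta coef_E0 coef_O0 sgnC sgn_set1 in_symdiff.
rewrite inE eqxx; have [jC|jC] := boolP (j \in C).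
  rewrite symdiff1_in // mul1r (cardsD1 j C) jC /= add0n.
  by case: ifP => //= oC; rewrite uphalf_half oC.
rewrite symdiff1_notin // cardsU1 jC /= add0n.
case: (boolP (odd #|C|)) => oC /=; last by rewrite mulr0.
by rewrite uphalf_half oC add1n expr1 exprS !mulN1r mulNr opprK.
Qed.

Lemma gen_E B j : gen R j * E_ R B = (-1) ^+ (j \in B) *: O_ R B.
Proof.
rewrite -sgn_set1 /O_ -(gen_E0 j) conjsM conjs_gen -scalerAl scalerA sgn_sqr.
by rewrite scale1r.
Qed.

Lemma gen_O B j : gen R j * O_ R B = - (-1) ^+ (j \in B) *: E_ R B.
Proof.
have -> : O_ R B = (-1) ^+ (j \in B) *: (gen R j * E_ R B).
  by rewrite gen_E scalerA -expr2 sqrr_sign scale1r.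
by rewrite -scalerAr mulrA -expr2 gen_sqr mulN1r scalerN scaleNr.
Qed.

Lemma coef_E B C : coef (E_ R B) C =
  sgn R B C * (if odd #|C| then 0 else (-1) ^+ #|C|./2 / 2 ^+ (n - 1)).
Proof. by rewrite coef_conjs coef_E0. Qed.

(** The span of [E_ B] and [O_ B] absorbs multiplication by the generators,
    by [gen_E] and [gen_O], hence by the whole algebra. *)
Lemma mulE_mem B (W : {vspace K}) U :
  E_ R B \in W -> O_ R B \in W -> U * E_ R B \in W.
Proof.
move=> EW OW; rewrite [U]blade_sum mulr_suml; apply: memv_suml => A _.
rewrite -scalerAl memvZ // /blade.
suff [] : (\prod_(i in A) gen R i) * E_ R B \in W /\
          (\prod_(i in A) gen R i) * O_ R B \in W by [].
elim/big_rec: _ => [|i V _ [VE VO]]; first by rewrite !mul1r.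
by split; rewrite (mulrC (gen R i)) -mulrA ?gen_E ?gen_O -scalerAr memvZ.
Qed.

(** * Orthogonality and decomposition of 1 *)

Variable hn : (1 <= n)%N.
Let i0 : 'I_n := Ordinal hn.

Lemma tail_idxE : tail_idx n = [set~ i0].
Proof. by apply/setP => i; rewrite !inE -val_eqE /= lt0n. Qed.

Lemma card_tail_idx : #|tail_idx n| = n.-1.
Proof. by rewrite tail_idxE cardsC1 card_ord. Qed.

Lemma first_notin B : B \subset tail_idx n -> i0 \notin B.
Proof. by move/subsetP => sB; apply/negP => /sB; rewrite tail_idxE !inE eqxx. Qed.

Lemma O_first B : B \subset tail_idx n -> O_ R B = gen R i0 * E_ R B.
Proof. by move=> sB; rewrite gen_E (negbTE (first_notin sB)) scale1r. Qed.

(** With j in exactly one of A and B, carrying e_j across the product gives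
    [O_ A * E_ B = - E_ A * O_ B], while e_1 gives the same with a plus sign;
    so both vanish, and e_1 is invertible. *)
Lemma E_orthogonal A B : A \subset tail_idx n -> B \subset tail_idx n ->
  A != B -> E_ R A * E_ R B = 0.
Proof.
move=> sA sB nAB.
have /existsP[j /eqP nj] : [exists j, (j \in B) == ~~ (j \in A)].
  apply: contraNT nAB; rewrite negb_exists => /forallP eAB.
  by apply/eqP/setP => j; move: (eAB j); case: (j \in A); case: (j \in B).
have OE : O_ R A * E_ R B = E_ R A * O_ R B.
  by rewrite !O_first // mulrCA mulrA.
have : gen R j * E_ R A * E_ R B = E_ R A * (gen R j * E_ R B).
  by rewrite mulrA (mulrC (gen R j)).
rewrite !gen_E nj -scalerAl -scalerAr OE signrN scaleNr => /eqP.
rewrite -addr_eq0 -mulr2n -scaler_nat !scaler_eq0 pnatr_eq0 signr_eq0 /=.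
rewrite (O_first sB) => /eqP EO0.
have : gen R i0 * (E_ R A * (gen R i0 * E_ R B)) = - (E_ R A * E_ R B).
  by rewrite mulrCA (mulrA (gen R i0)) -expr2 gen_sqr mulN1r mulrN.
by rewrite EO0 mulr0 => /esym/eqP; rewrite oppr_eq0 => /eqP.
Qed.

(** Toggling j in the index B permutes the range of the sum and flips the sign
    of [sgn R B C]. *)
Lemma sum_sgn C j : j \in C -> j \in tail_idx n ->
  \sum_(B in powerset (tail_idx n)) sgn R B C = 0.
Proof.
move=> jC jt; set S := \sum_(B in _) _.
have : S = - S.
  rewrite {1}/S (reindex_inj (inv_inj (symdiffK [set j]))) /= -sumrN.
  apply: eq_big => [B|B _].
    rewrite !powersetE; apply/subsetP/subsetP => sB i iB.
      have [->|nij] := eqVneq i j; first by [].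
      by apply: sB; rewrite in_symdiff inE (negbTE nij).
    move: iB; rewrite in_symdiff inE.
    by have [->|nij] := eqVneq i j => //= /sB.
  by rewrite sgnC sgn_symdiff sgn_set1 jC expr1 mulN1r sgnC.
by move/eqP; rewrite -addr_eq0 -mulr2n -mulr_natr mulf_eq0 pnatr_eq0 orbF => /eqP.
Qed.

(** Only the coordinates whose index avoids {2, ..., n} survive the character
    sum; of these the empty set gives 1, and {1} has odd cardinality. *)
Lemma sum_E : \sum_(B in powerset (tail_idx n)) E_ R B = 1.
Proof.
apply: coefP => C; rewrite coef_sum coef1.
under eq_bigr => B _ do rewrite coef_E.
rewrite -mulr_suml; have [/eqP C0|[j /setIP[jC jt]]] := set_0Vmem (C :&: tail_idx n).
  have sC : C \subset [set i0].
    by rewrite -(setCK [set i0]) -disjoints_subset -setI_eq0 -tail_idxE.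
  move: sC; rewrite subset1 => /orP[/eqP->|/eqP->].
    by rewrite cards1 mulr0 -cards_eq0 cards1.
  rewrite eqxx cards0 mul1r /=.
  under eq_bigr => B _ do rewrite /sgn setI0 cards0.
  rewrite sumr_const card_powerset card_tail_idx subn1 natrX divff //.
  by rewrite expf_neq0 // pnatr_eq0.
rewrite (sum_sgn jC jt) mul0r; case: eqP => // C0.
by rewrite C0 inE in jC.
Qed.

Lemma E_idempotent A : A \subset tail_idx n -> E_ R A * E_ R A = E_ R A.
Proof.
move=> sA; rewrite -[RHS]mulr1 -sum_E mulr_sumr (bigD1 A) ?powersetE //=.
rewrite big1 ?addr0 // => B /andP[]; rewrite powersetE eq_sym => sB nAB.
exact: E_orthogonal.
Qed.

Lemma EE A B : A \subset tail_idx n -> B \subset tail_idx n ->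
  E_ R A * E_ R B = if A == B then E_ R A else 0.
Proof.
move=> sA sB; have [<-|nAB] := eqVneq A B; first exact: E_idempotent.
exact: E_orthogonal.
Qed.

Lemma EO_basis : basis_of (fullv : {vspace K})
  ([seq E_ R B | B : {set 'I_n} in powerset (tail_idx n)]
   ++ [seq O_ R B | B : {set 'I_n} in powerset (tail_idx n)]).
Proof.
rewrite basisEdim; apply/andP; split; last first.
  rewrite size_cat !size_image card_powerset card_tail_idx addnn -mul2n -expnS.
  by rewrite prednK // dimvf /= [leqRHS]muln1 -cardsT -powersetT card_powerset
    cardsT card_ord.
apply/subvP => U _; rewrite -[U]mulr1 -sum_E mulr_sumr.
apply: memv_suml => B sB; apply: mulE_mem; apply: memv_span; rewrite mem_cat.
  by rewrite image_f.
by rewrite image_f ?orbT.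
Qed.

End Idempotents.

Theorem theorem6p10 (R : realType) (n : nat) (hn : (1 <= n)%N) :
  (forall A B : {set 'I_n}, A \subset tail_idx n -> B \subset tail_idx n ->
    [/\ E_ R A * E_ R B = (if A == B then E_ R A else 0),
        E_ R A * O_ R B = (if A == B then O_ R A else 0)
      & O_ R A * O_ R B = (if A == B then - E_ R A else 0)])
  /\ basis_of (fullv : {vspace K0 R n})
       ([seq E_ R B | B : {set 'I_n} in powerset (tail_idx n)]
        ++ [seq O_ R B | B : {set 'I_n} in powerset (tail_idx n)]).
Proof.
split; last exact: EO_basis.
move=> A B sA sB; split; first exact: EE.
  by rewrite !(O_first R hn) // mulrCA EE //; case: ifP; rewrite ?mulr0.
rewrite !(O_first R hn) // mulrACA -expr2 gen_sqr mulN1r EE //.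
by case: ifP; rewrite ?oppr0.
Qed.
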